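(* Let $A=K[x_1,x_2,\ldots,x_n]$ be the polynomial algebra over a field $K$ of characteristic zero in $n\geq 2$ variables $x_1,\ldots,x_n$, let $d\geq 2$, and let $A_0$ be the Veronese subalgebra of $A$ of degree $d$. Then every derivation of $A_0$ can be uniquely extended to a $d$-graded derivation of $K[x_1,x_2,\ldots,x_n]$.
   Context: For $0\le i\le d-1$ let $A_i$ be the $K$-linear span of all monomials of $A$ of total degree $kd+i$, $k\geq 0$; then $A=A_0\oplus A_1\oplus\cdots\oplus A_{d-1}$ is a $\mathbb{Z}/d\mathbb{Z}$-grading. The subalgebra $A_0$ is the Veronese subalgebra of $A$ of degree $d$. Derivations are $K$-linear. A derivation $D$ of $A$ is called $d$-graded if $D(x_1),\ldots,D(x_n)\in A_1$. *)

(* Defs.v *)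
From HB Require Import structures.
From mathcomp Require Import all_boot all_order all_algebra.
From mathcomp Require Import mpoly.

Set Implicit Arguments.
Unset Strict Implicit.
Unset Printing Implicit Defensive.

Import GRing.Theory.
Local Open Scope ring_scope.

Section Veronese.
Context (K : fieldType) (n d : nat).

(* The component A_i of the Z/dZ-grading of {mpoly K[n]}, for i < d; being a
   span of monomials, it is cut out by a condition on the support, see
   [graded_part_spanP]. *)
Definition graded_part (i : nat) : {pred {mpoly K[n]}} :=
  fun p => all (fun m => mdeg m == i %[mod d]) (msupp p).

Lemma graded_partP i (p : {mpoly K[n]}) :
  reflect (forall m, p@_m != 0 -> mdeg m = i %[mod d]) (p \in graded_part i).
Proof.
apply: (iffP allP) => h m; first by rewrite -mcoeff_msupp => /h/eqP.
by rewrite mcoeff_msupp => /h ->.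
Qed.

Lemma graded_part_spanP i (p : {mpoly K[n]}) : (i < d)%N ->
  p \in graded_part i <->
  exists (s : seq 'X_{1..n}) (c : 'X_{1..n} -> K),
    (forall m, m \in s -> exists k, mdeg m = (k * d + i)%N) /\
    p = \sum_(m <- s) c m *: 'X_[m].
Proof.
move=> lt_id; split=> [/allP hp | [s [c [hs ->]]]].
  exists (msupp p), (fun m => p@_m); split; last exact: mpolyE.
  move=> m /hp/eqP; rewrite (modn_small lt_id) => <-.
  by exists (mdeg m %/ d)%N; rewrite -divn_eq.
apply/graded_partP => m; rewrite linear_sum /= => nz.
suff /hs [k ->] : m \in s by rewrite modnMDl.
apply: contraNT nz => /negP m_s; rewrite big_seq big1 // => m' s_m'.
rewrite mcoeffZ mcoeffX; case: eqP => [e|_]; last by rewrite mulr0.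
by case: m_s; rewrite -e.
Qed.

Lemma graded_part0_subalg : subalg_closed (graded_part 0).
Proof.
split=> [|c p q /graded_partP hp /graded_partP hq|p q /allP hp /allP hq].
- by apply/allP => m; rewrite msupp1 inE => /eqP ->; rewrite mdeg0.
- apply/graded_partP => m; rewrite mcoeffD mcoeffZ => nz.
  case: (eqVneq p@_m 0) => [p0|/hp //].
  by apply: hq; move: nz; rewrite p0 mulr0 add0r.
apply/allP => m /msuppM_le /allpairsP [[m1 m2] /= [/hp/eqP e1 /hq/eqP e2 ->]].
by rewrite mdegD -modnDm e1 e2 modnDm.
Qed.

HB.instance Definition _ :=
  GRing.isSubalgClosed.Build K {mpoly K[n]} (graded_part 0)
    (GRing.subalg_closed_semi graded_part0_subalg).

Record veronese :=
  Veronese { veronese_val :> {mpoly K[n]}; _ : veronese_val \in graded_part 0 }.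

HB.instance Definition _ := [isSub for veronese_val].
HB.instance Definition _ := [Choice of veronese by <:].
HB.instance Definition _ := [SubChoice_isSubAlgebra of veronese by <:].

End Veronese.

Definition is_derivation (K : fieldType) (B : algType K) (D : B -> B) : Prop :=
  linear D /\ forall a b : B, D (a * b) = D a * b + a * D b.

Definition is_graded_derivation (K : fieldType) (n d : nat)
    (D : {mpoly K[n]} -> {mpoly K[n]}) : Prop :=
  is_derivation D /\ forall i : 'I_n, D 'X_i \in graded_part d 1.

(* Main.v *)
(* Monomials of degree divisible by d lie in A_0; in particular x_i^d does.
   From D(x_i^d) = d x_i^(d-1) E(x_i), the values E(x_i) are forced; they are
   polynomials because x_i^(d-1) divides D(x_i^d), which follows by applying D
   to (x_i x_j^(d-1))^d = x_i^d (x_j^d)^(d-1) with j distinct from i.  The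
   resulting E agrees with D on a monomial m of A_0 since m^d is a product of
   powers of the x_i^d and, in characteristic zero, a map satisfying the Leibniz
   rule that kills m^d kills m.  The same remark gives uniqueness. *)
Require Import Defs.
From HB Require Import structures.
From mathcomp Require Import all_boot all_order all_algebra.
From mathcomp Require Import mpoly.
From mathcomp Require Import ring.
From Stdlib Require Import FunctionalExtensionality.

Set Implicit Arguments.
Unset Strict Implicit.

Import GRing.Theory.
Local Open Scope ring_scope.

(** * Leibniz rules along a ring morphism *)

Section TwistedLeibniz.
Context (B : nzRingType) (C : idomainType) (phi : {rmorphism B -> C}).
Context (f : B -> C).
(** The twist by [phi] covers two cases: [phi := idfun] for maps of A to itself, and [phi := \val]
    for maps from A_0 to A. *)
Hypothesis fM : forall a b, f (a * b) = f a * phi b + phi a * f b.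

Lemma leibniz1 : f 1 = 0.
Proof.
by apply: (addrI (f 1)); rewrite addr0 -{3}[1]mulr1 fM rmorph1 mulr1 mul1r.
Qed.

Lemma leibnizX a k : f (a ^+ k) = k%:R * phi a ^+ k.-1 * f a.
Proof.
elim: k => [|[|k] IH]; first by rewrite expr0 leibniz1 !mul0r.
  by rewrite expr1 expr0 !mul1r.
rewrite exprS fM IH rmorphXn -[k.+2]add1n natrD !mulrDl !mul1r mulrC.
congr (_ + _).
by rewrite exprS !mulrA [phi a * _]mulrC.
Qed.

Lemma leibnizX_eq0 a k : f a = 0 -> f (a ^+ k) = 0.
Proof. by move=> fa; rewrite leibnizX fa mulr0. Qed.

Lemma leibniz_prod_eq0 (I : Type) (r : seq I) (F : I -> B) :
  (forall i, f (F i) = 0) -> f (\prod_(i <- r) F i) = 0.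
Proof.
move=> F0; elim/big_rec: _ => [|i x _ fx]; first exact: leibniz1.
by rewrite fM F0 fx mul0r mulr0 addr0.
Qed.

(** By [leibnizX], a product with nonzero factors k and phi(a)^(k-1) vanishes in a domain, so its
    last factor f(a) is zero. *)
Lemma leibniz_root_eq0 a k :
  (k%:R != 0 :> C) -> phi a != 0 -> f (a ^+ k) = 0 -> f a = 0.
Proof.
move=> k0 a0 /eqP; rewrite leibnizX !mulf_eq0 (negPf k0) /=.
by rewrite expf_eq0 (negPf a0) andbF => /eqP.
Qed.

End TwistedLeibniz.

(** * Divisibility by monomials *)

Section MonomialDivisibility.
Context (n : nat) (K : idomainType).
Implicit Types (p q r : {mpoly K[n]}) (m : 'X_{1..n}).

Lemma mcoeffMX_neq0 q m k : (q * 'X_[m])@_k != 0 -> (m <= k)%MM.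
Proof.
rewrite -mcoeff_msupp (perm_mem (msuppMX q m)) => /mapP [k' _ ->].
by apply/mnm_lepP => i; rewrite mnmDE leq_addr.
Qed.

Lemma mpolyX_neq0 m : 'X_[m] != 0 :> {mpoly K[n]}.
Proof. by rewrite -msupp_eq0 msuppX. Qed.

Lemma mpolyX_dvd p m :
  (forall k, p@_k != 0 -> (m <= k)%MM) -> exists q, p = q * 'X_[m].
Proof.
move=> hp; exists (\sum_(k <- msupp p) p@_k *: 'X_[k - m]).
rewrite mulr_suml {1}[p]mpolyE; apply: eq_big_seq => k.
rewrite mcoeff_msupp => /hp le_mk.
by rewrite -scalerAl -mpolyXD submK.
Qed.

(** Every exponent k of p satisfies m <= m' + k; at each index either m or m' is zero, so m <= k
    already. *)
Lemma mpolyX_gauss p q m m' :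
  (forall i, (m i == 0%N) || (m' i == 0%N)) ->
  p * 'X_[m'] = q * 'X_[m] -> exists r, p = r * 'X_[m].
Proof.
move=> disj e; apply: mpolyX_dvd => k.
rewrite -(mcoeffMX p m') e => /mcoeffMX_neq0.
move/mnm_lepP => le; apply/mnm_lepP => i; move: (le i); rewrite mnmDE.
by case/orP: (disj i) => /eqP ->.
Qed.

End MonomialDivisibility.

Lemma mpoly_natf_neq0 (K : fieldType) (n k : nat) :
  [pchar K] =i pred0 -> (0 < k)%N -> (k%:R != 0 :> {mpoly K[n]}).
Proof.
move=> /pcharf0P char0 k0.
by rewrite -(rmorph_nat (@mpolyC n K)) mpolyC_eq0 char0 -lt0n.
Qed.

(** Linearity is taken as a bare proposition, the form in which [is_derivation] provides it, and
    bundled inside the proof. *)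
Lemma linear_comb_eq0 (R : nzRingType) (U V : lmodType R) (f : U -> V)
    (I : eqType) (s : seq I) (c : I -> R) (v : I -> U) :
  linear f -> {in s, forall i, f (v i) = 0} -> f (\sum_(i <- s) c i *: v i) = 0.
Proof.
move=> lf f0.
pose F := HB.pack_for {linear U -> V} f (GRing.isLinear.Build R U V _ f lf).
rewrite -[f]/(F : _ -> _) linear_sum big_seq big1 // => i /f0 fi0.
by rewrite linearZ /= fi0 scaler0.
Qed.

(** * Monomials of A_0 *)

Section VeroneseMonomials.
Context (K : fieldType) (n d : nat).

(* Junk value 0 when d does not divide the degree of m. *)
Definition veronese_mon (m : 'X_{1..n}) : veronese K n d := insubd 0 'X_[m].

Lemma val_veronese_mon m : (d %| mdeg m)%N -> val (veronese_mon m) = 'X_[m].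
Proof.
move=> dm; rewrite insubdK //; apply/graded_partP => k.
rewrite mcoeffX; case: (m =P k) => [<- _|_]; last by rewrite eqxx.
by rewrite mod0n; apply/eqP.
Qed.

Lemma veronese_msupp_dvd (a : veronese K n d) m :
  m \in msupp (val a) -> (d %| mdeg m)%N.
Proof.
have /allP h : val a \in graded_part d 0 := valP a.
by move=> /h; rewrite mod0n.
Qed.

Lemma veronese_monE (a : veronese K n d) :
  a = \sum_(m <- msupp (val a)) (val a)@_m *: veronese_mon m.
Proof.
apply: val_inj; rewrite {1}[val a]mpolyE linear_sum; apply: eq_big_seq => m ms.
by rewrite linearZ /= val_veronese_mon // (veronese_msupp_dvd ms).
Qed.

End VeroneseMonomials.

(** * Extending derivations from A_0 to A *)

Section Extension.
Context (K : fieldType) (n d : nat).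
Context (char0 : [pchar K] =i pred0) (n_ge2 : (2 <= n)%N) (d_ge2 : (2 <= d)%N).
Context (D : veronese K n d -> veronese K n d) (derD : is_derivation D).

Local Notation vmon := (veronese_mon K d).

Let d_gt0 : (0 < d)%N. Proof. exact: ltnW. Qed.

Let valDM (a b : veronese K n d) :
  val (D (a * b)) = val (D a) * val b + val a * val (D b).
Proof. by rewrite derD.2 rmorphD !rmorphM. Qed.

Let dvd_mdegMn (m : 'X_{1..n}) : (d %| mdeg (m *+ d)%MM)%N.
Proof. by rewrite mdegMn dvdn_mull. Qed.

(* In the expansion of D((x_i x_j^(d-1))^d) = D(x_i^d (x_j^d)^(d-1)), every
   term except x_j^(d(d-1)) D(x_i^d) is visibly divisible by x_i^(d-1). *)
Lemma der_power_dvd (i : 'I_n) : exists h : {mpoly K[n]},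
  val (D (vmon (U_(i) *+ d)%MM)) = h * 'X_[U_(i) *+ d.-1].
Proof.
have [j neq_ij] : exists j : 'I_n, i != j.
  have [i0|i0] := eqVneq (val i) 0%N.
    by exists (Ordinal n_ge2); rewrite -val_eqE /= i0.
  by exists (Ordinal (ltnW n_ge2)).
set xi := vmon _; pose xj := vmon (U_(j) *+ d)%MM.
pose u := vmon (U_(i) + U_(j) *+ d.-1)%MM.
have vu : val u = 'X_[U_(i) + U_(j) *+ d.-1].
  by rewrite val_veronese_mon // mdegD mdegMn !mdeg1 mul1n add1n prednK.
have vxi : val xi = 'X_[U_(i) *+ d] by rewrite val_veronese_mon.
have vxj : val xj = 'X_[U_(j) *+ d] by rewrite val_veronese_mon.
have e : u ^+ d = xi * xj ^+ d.-1.
  apply: val_inj; rewrite rmorphM !rmorphXn.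
  rewrite [X in X ^+ d]vu [X in X * _]vxi [X in _ * X ^+ _]vxj.
  rewrite !mpolyXn -mpolyXD; congr 'X_[_]; apply/mnmP => k.
  by rewrite !(mnmDE, mulmnE) mulnDl -!mulnA [(d * _)%N]mulnC.
have := valDM xi (xj ^+ d.-1); rewrite -e.
rewrite (leibnizX (phi := \val) valDM) [X in X * _ + _]/= => e2.
(* The cofactor of x_i^(d-1) in D(u^d) - x_i^d D((x_j^d)^(d-1)), where D(u^d) = d u^(d-1) D(u). *)
pose q := d%:R * 'X_[U_(j) *+ d.-1] ^+ d.-1 * val (D u)
          - 'X_[U_(i)] * val (D (xj ^+ d.-1)).
apply: (@mpolyX_gauss _ _ _ q _ (U_(j) *+ d *+ d.-1)%MM).
  move=> k; rewrite !mulmnE !mnm1E.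
  by have [<-|] := eqVneq i k; rewrite // [j == i]eq_sym (negPf neq_ij) orbT.
have vxjX : val (xj ^+ d.-1) = 'X_[U_(j) *+ d *+ d.-1].
  by rewrite rmorphXn [X in X ^+ _]vxj mpolyXn.
rewrite -[X in _ * X]vxjX; apply: (addIr (val xi * val (D (xj ^+ d.-1)))).
rewrite -e2 [X in X ^+ _]vu [X in _ = _ + X * _]vxi /q.
have Xd : 'X_[U_(i) *+ d] = 'X_i * 'X_[U_(i) *+ d.-1] :> {mpoly K[n]}.
  by rewrite -mpolyXD -mulmS prednK.
rewrite mpolyXD exprMn Xd -(mpolyXn _ U_(i)%MM).
ring.
Qed.

Let natd_neq0 : d%:R != 0 :> {mpoly K[n]}.
Proof. exact: mpoly_natf_neq0. Qed.

Let scald_neq0 : d%:R != 0 :> K.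
Proof. by move/pcharf0P: char0 => ->; rewrite -lt0n. Qed.

Lemma der_extension_exists : exists E : {mpoly K[n]} -> {mpoly K[n]},
  is_graded_derivation d E /\ forall a, E (val a) = val (D a).
Proof.
have [h hE] := fin_all_exists der_power_dvd.
(* The derivation of A sending x_i to h_i/d, where h_i = D(x_i^d)/x_i^(d-1). *)
pose E p := \sum_i p^`M(i) * (d%:R^-1 *: h i).
have linE : linear E.
  move=> c p q; rewrite /E scaler_sumr -big_split; apply: eq_bigr => i _ /=.
  by rewrite linearP mulrDl scalerAl.
have EM p q : E (p * q) = E p * q + p * E q.
  rewrite /E mulr_suml mulr_sumr -big_split; apply: eq_bigr => i _ /=.
  by rewrite mderivM; ring.
have EX i : E 'X_i = d%:R^-1 *: h i.
  rewrite /E (bigD1 i) //= big1 => [|j neq_ji].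
    rewrite mderivX mnm1E eqxx -{1}[U_(i)%MM]add0m addmK mpolyX0.
    by rewrite scale1r mul1r addr0.
  by rewrite mderivX mnm1E eq_sym (negPf neq_ji) scale0r mul0r.
exists E; split.
  split=> // i; rewrite EX; apply/graded_partP => m; rewrite mcoeffZ mulf_eq0.
  (* Since h_i x_i^(d-1) lies in A_0, each exponent m of h_i has deg m + d - 1 divisible by d, that
     is, deg m congruent to 1. *)
  case/norP=> _; rewrite -(mcoeffMX _ (U_(i) *+ d.-1)%MM) -hE -mcoeff_msupp.
  move=> /veronese_msupp_dvd; rewrite mdegD mdegMn mdeg1 mul1n => dvd.
  apply/eqP; rewrite -(eqn_modDl d.-1) addn1 prednK // modnn.
  exact: dvd.
(* The discrepancy on A_0 is linear and Leibniz along [\val], so it is enough to kill the monomials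
   of A_0. *)
pose f a := E (val a) - val (D a).
have fM a b : f (a * b) = f a * val b + val a * f b.
  by rewrite /f rmorphM EM valDM; ring.
have linf : linear f.
  move=> c a b; rewrite /f derD.1 !linearP linE /=.
  by rewrite scalerBr -scalerN addrACA.
have fX i : f (vmon (U_(i) *+ d)%MM) = 0.
  rewrite /f hE val_veronese_mon // -mpolyXn (leibnizX (phi := idfun) EM) EX.
  rewrite -scalerAr -mulrA mulr_natl -scaler_nat scalerA mulVf // scale1r.
  by rewrite mulrC mpolyXn subrr.
move=> a; apply/eqP; rewrite -subr_eq0 -/(f a); apply/eqP.
rewrite [a]veronese_monE; apply: linear_comb_eq0 => // m /veronese_msupp_dvd dm.
apply: (leibniz_root_eq0 (phi := \val) fM natd_neq0).
  by rewrite /= val_veronese_mon // mpolyX_neq0.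
have -> : vmon m ^+ d = \prod_i vmon (U_(i) *+ d)%MM ^+ m i.
  apply: val_inj; rewrite rmorphXn rmorph_prod [X in X ^+ _]val_veronese_mon //.
  rewrite mpolyXE_id -prodrXl; apply: eq_bigr => i _.
  by rewrite rmorphXn /= val_veronese_mon // -mpolyXn -!exprM mulnC.
apply: (leibniz_prod_eq0 (phi := \val) fM) => i.
exact: (leibnizX_eq0 (phi := \val) fM).
Qed.

(** For any monomial m of A, m^d lies in A_0, so E - E' kills m^d and hence m. Functional
    extensionality gives the equality of functions that [exists!] requires. *)
Lemma der_extension_unique (E E' : {mpoly K[n]} -> {mpoly K[n]}) :
  is_derivation E -> is_derivation E' ->
  (forall a : veronese K n d, E (val a) = E' (val a)) -> E = E'.
Proof.
move=> [linE EM] [linE' EM'] eqEE'; apply: functional_extensionality => p.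
pose f q := E q - E' q.
have fM a b : f (a * b) = f a * b + a * f b by rewrite /f EM EM'; ring.
have linf : linear f.
  by move=> c a b; rewrite /f linE linE' scalerBr opprD addrACA.
apply/eqP; rewrite -subr_eq0 -/(f p); apply/eqP.
rewrite [p]mpolyE; apply: linear_comb_eq0 => // m _.
apply: (leibniz_root_eq0 (phi := idfun) fM natd_neq0).
  exact: mpolyX_neq0.
rewrite mpolyXn -(@val_veronese_mon K n d) //.
by rewrite /f eqEE' subrr.
Qed.

End Extension.

Theorem corollary2 (K : fieldType) (n d : nat)
  (char0 : [pchar K] =i pred0) (n_ge2 : (2 <= n)%N) (d_ge2 : (2 <= d)%N)
  (D : veronese K n d -> veronese K n d) (derD : is_derivation D) :
  exists! E : {mpoly K[n]} -> {mpoly K[n]},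
    is_graded_derivation d E /\
    forall a : veronese K n d, E (val a) = val (D a).
Proof.
have [E [gE extE]] := der_extension_exists char0 n_ge2 d_ge2 derD.
exists E; split=> // E' [gE' extE'].
apply: (der_extension_unique (d := d) char0 d_ge2 gE.1 gE'.1) => a.
by rewrite extE extE'.
Qed.
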